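(* Let $1\le r<n$. An immersed (connected) hypersurface $M$ in $\mathbb{H}^n\times\mathbb{R}$ with prescribed $r$-mean curvature function $H_r:M\longrightarrow\left(0,\frac{n-r}{n}\right]$ cannot be compact without boundary.
   Context: $\mathbb{H}^n$ is hyperbolic space and $\mathbb{H}^n\times\mathbb{R}$ has the product metric. For an oriented $n$-dimensional hypersurface with principal curvatures $k_1,\ldots,k_n$, $H_r=\binom{n}{r}^{-1}\sum_{i_1<\cdots<i_r}k_{i_1}\cdots k_{i_r}$ (a function on $M$, not assumed constant here). *)

(* Defs.v *)
From HB Require Import structures.
From mathcomp Require Import all_boot all_order all_algebra.
From mathcomp Require Import all_classical all_reals all_analysis.

Set Implicit Arguments.
Unset Strict Implicit.
Unset Printing Implicit Defensive.

Import Order.TTheory GRing.Theory Num.Theory.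
Import numFieldNormedType.Exports.

Local Open Scope classical_set_scope.
Local Open Scope ring_scope.

(* In finite dimension, and for U open, this is the usual class C^k: requiring
   differentiability together with C^(k-1) directional derivatives amounts to
   requiring that all partial derivatives of order <= k exist and are
   continuous. *)
Fixpoint Ck_on (R : realType) (V W : normedModType R) (k : nat)
    (U : set V) (f : V -> W) : Prop :=
  match k with
  | 0 => forall x, U x -> {for x, continuous f}
  | k'.+1 => (forall x, U x -> differentiable f x) /\
             (forall v : V, Ck_on k' U ('D_v f))
  end.

Definition smooth_on (R : realType) (V W : normedModType R)
    (U : set V) (f : V -> W) : Prop :=
  forall k : nat, Ck_on k U f.

(* The maps of a chart are total functions; they are only meaningful on
   chart_dom c and on its image chart_im c respectively. *)
Record chart (R : realType) (n : nat) (M : topologicalType) := Chart {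
  chart_dom : set M;
  chart_fun : M -> 'rV[R]_n;
  chart_inv : 'rV[R]_n -> M }.

Definition chart_im (R : realType) (n : nat) (M : topologicalType)
    (c : chart R n M) : set 'rV[R]_n := chart_fun c @` chart_dom c.

(* c is a homeomorphism from an open set of M onto an open set of R^n. *)
Record is_chart (R : realType) (n : nat) (M : topologicalType)
    (c : chart R n M) : Prop := IsChart {
  chart_dom_open : open (chart_dom c);
  chart_im_open : open (chart_im c);
  chart_funK : forall p, chart_dom c p -> chart_inv c (chart_fun c p) = p;
  chart_fun_continuous :
    forall p, chart_dom c p -> {for p, continuous (chart_fun c)};
  chart_inv_continuous :
    forall x, chart_im c x -> {for x, continuous (chart_inv c)} }.

(* Charts have open images in R^n (not in a half-space), so the manifolds
   below have no boundary. *)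
Record smooth_manifold (R : realType) (n : nat) (M : topologicalType)
    (atlas : set (chart R n M)) : Prop := SmoothManifold {
  manifold_hausdorff : hausdorff_space M;
  manifold_second_countable : @second_countable M;
  atlas_chart : forall c, atlas c -> is_chart c;
  atlas_cover : forall p : M, exists2 c, atlas c & chart_dom c p;
  atlas_compatible : forall c d, atlas c -> atlas d ->
    smooth_on (chart_fun c @` (chart_dom c `&` chart_dom d))
              (chart_fun d \o chart_inv c) }.

(* An open subset Omega of R^m serves as ambient manifold. *)
Record smooth_immersion (R : realType) (n m : nat) (M : topologicalType)
    (atlas : set (chart R n M)) (Omega : set 'rV[R]_m) (f : M -> 'rV[R]_m) :
    Prop := SmoothImmersion {
  immersion_into : forall p, Omega (f p);
  immersion_smooth : forall c, atlas c ->
    smooth_on (chart_im c) (f \o chart_inv c);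
  immersion_injective_differential : forall c x, atlas c -> chart_im c x ->
    row_free (jacobian (f \o chart_inv c) x) }.

(* A Riemannian metric on an open subset of R^m is given by its Gram matrix
   in the standard coordinates. *)
Definition metric_field (R : realType) (m : nat) := 'rV[R]_m -> 'M[R]_m.

Definition inner (R : realType) (m : nat) (g : metric_field R m)
    (x u v : 'rV[R]_m) : R := (u *m g x *m v^T) 0 0.

Definition partial (R : realType) (n : nat) (W : normedModType R)
    (i : 'I_n) (f : 'rV[R]_n -> W) : 'rV[R]_n -> W := 'D_(delta_mx 0 i) f.

(* Christoffel symbols Gamma^a_{bc} of the Levi-Civita connection of g. *)
Definition christoffel (R : realType) (m : nat) (g : metric_field R m)
    (x : 'rV[R]_m) (a b c : 'I_m) : R :=
  2^-1 * \sum_(d < m) invmx (g x) a d *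
    (partial b (fun y => g y d c) x + partial c (fun y => g y d b) x
     - partial d (fun y => g y b c) x).

(* The Levi-Civita covariant derivative, along the parametrization F, of the
   coordinate field d_j F in the direction d_i. *)
Definition cov_partial (R : realType) (n m : nat) (g : metric_field R m)
    (F : 'rV[R]_n -> 'rV[R]_m) (x : 'rV[R]_n) (i j : 'I_n) : 'rV[R]_m :=
  partial i (partial j F) x +
  \row_a \sum_(b < m) \sum_(c < m)
     christoffel g (F x) a b c * partial i F x 0 b * partial j F x 0 c.

Definition first_form (R : realType) (n m : nat) (g : metric_field R m)
    (F : 'rV[R]_n -> 'rV[R]_m) (x : 'rV[R]_n) : 'M[R]_n :=
  \matrix_(i, j) inner g (F x) (partial i F x) (partial j F x).

Definition second_form (R : realType) (n m : nat) (g : metric_field R m)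
    (F nu : 'rV[R]_n -> 'rV[R]_m) (x : 'rV[R]_n) : 'M[R]_n :=
  \matrix_(i, j) inner g (F x) (cov_partial g F x i j) (nu x).

(* Matrix of the shape operator S, defined by <S X, Y> = II(X, Y), in the
   basis d_1 F, ..., d_n F; row i holds the coordinates of S (d_i F). *)
Definition shape_operator (R : realType) (n m : nat) (g : metric_field R m)
    (F nu : 'rV[R]_n -> 'rV[R]_m) (x : 'rV[R]_n) : 'M[R]_n :=
  second_form g F nu x *m invmx (first_form g F x).

(* An orientation of the hypersurface f, as a global unit normal field. *)
Record unit_normal (R : realType) (n m : nat) (M : topologicalType)
    (atlas : set (chart R n M)) (g : metric_field R m)
    (f nu : M -> 'rV[R]_m) : Prop := UnitNormal {
  normal_continuous : continuous nu;
  normal_unit : forall p, inner g (f p) (nu p) (nu p) = 1;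
  normal_orthogonal : forall c p i, atlas c -> chart_dom c p ->
    inner g (f p) (partial i (f \o chart_inv c) (chart_fun c p)) (nu p) = 0 }.

(* k lists the eigenvalues, with multiplicity, of the shape operator at p. *)
Definition principal_curvatures (R : realType) (n m : nat)
    (M : topologicalType) (atlas : set (chart R n M)) (g : metric_field R m)
    (f nu : M -> 'rV[R]_m) (p : M) (k : 'I_n -> R) : Prop :=
  forall c, atlas c -> chart_dom c p ->
    char_poly (shape_operator g (f \o chart_inv c) (nu \o chart_inv c)
                              (chart_fun c p))
    = \prod_(i < n) ('X - (k i)%:P).

Definition r_mean_curvature (R : realType) (n r : nat) (k : 'I_n -> R) : R :=
  ('C(n, r)%:R)^-1 * \sum_(A : {set 'I_n} | #|A| == r) \prod_(i in A) k i.

Definition sqnorm (R : realType) (n : nat) (x : 'rV[R]_n) : R :=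
  \sum_(i < n) x 0 i ^+ 2.

(* Hyperbolic space is taken in the Poincare ball model. *)
Definition hyperbolic_ball (R : realType) (n : nat) : set 'rV[R]_n :=
  [set x | sqnorm x < 1].

Definition hyperbolic_metric (R : realType) (n : nat) : metric_field R n :=
  fun x => ((2 / (1 - sqnorm x)) ^+ 2)%:M.

(* H^n x R: the first n coordinates lie in the ball, the last one is free. *)
Definition HnxR (R : realType) (n : nat) : set 'rV[R]_(n + 1) :=
  [set x | hyperbolic_ball (lsubmx x)].

Arguments HnxR : clear implicits.

Definition HnxR_metric (R : realType) (n : nat) : metric_field R (n + 1) :=
  fun x => block_mx (hyperbolic_metric (lsubmx x)) 0 0 1%:M.

Arguments HnxR_metric : clear implicits.

(* Main.v *)
Require Import Defs.
From HB Require Import structures.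
From mathcomp Require Import all_boot all_order all_algebra.
From mathcomp Require Import all_classical all_reals all_analysis.
From mathcomp Require Import ring lra.

(* In the ball model write l = 2 / (1 - |y|^2) for the conformal factor, so
   that cosh d(0, y) = l - 1.  The function Phi(y, t) = l(y) - t has Hessian
   (l - 1) g_H on H^n x R and a gradient of length l - 1, so its level sets are
   translates of the convex entire graph t = cosh d(0, y), all of whose r-mean
   curvatures exceed (n - r)/n.  If M is compact, Phi has a maximum on M.
   There dPhi is normal to M, and the second derivative test gives
   II(v, v) >= |v|^2 - <v, d/dt>^2 for one choice of the unit normal.  In an
   orthonormal basis of principal directions v_i this reads k_i >= 1 - t_i with
   t_i = <v_i, d/dt>^2, where sum t_i = 1 - <nu, d/dt>^2 < 1.  By
   Weierstrass' inequality prod (1 - t_i) >= 1 - sum t_i, the r-th elementary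
   symmetric function of the k_i is greater than C(n-1, r) = C(n, r) (n - r)/n.
   Reversing the normal multiplies H_r by (-1)^r, so this contradicts
   0 < H_r <= (n - r)/n in either case. *)

Set Implicit Arguments.
Unset Strict Implicit.
Unset Printing Implicit Defensive.

Import Order.TTheory GRing.Theory Num.Theory.
Import numFieldNormedType.Exports.

Local Open Scope ring_scope.

(** * Symmetric functions and simultaneous diagonalization *)

Lemma prod_one_minus_ge (R : realDomainType) (I : finType) (A : {set I})
    (t : I -> R) (ht : forall i, 0 <= t i <= 1) :
  1 - \sum_(i in A) t i <= \prod_(i in A) (1 - t i).
Proof.
(* Bounding the product as well makes the claim inductive: for factors [x] and [y] at most 1,
   [x y >= x + y - 1]. *)
suff [//]: [/\ 1 - \sum_(i in A) t i <= \prod_(i in A) (1 - t i),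
               0 <= \sum_(i in A) t i & 0 <= \prod_(i in A) (1 - t i) <= 1].
elim/big_ind2: _ => [|x1 x2 y1 y2 [] h1 h2 /andP[h3 h4] [] h5 h6 /andP[h7 h8]|i _].
- by rewrite subr0 ler01 !lexx.
- split; [|exact: addr_ge0|]; last by rewrite mulr_ge0 //= mulr_ile1.
  nra.
- by have /andP[? ?] := ht i; rewrite lexx; split=> //; lra.
Qed.

(** The [r]-subsets avoiding [i] are those of its complement, which has [n.-1] elements; the
    additive form avoids subtraction on naturals. *)
Lemma card_draws_mem n r (i : 'I_n) :
  (#|[set A : {set 'I_n} | (#|A| == r) && (i \in A)]| + 'C(n.-1, r) = 'C(n, r))%N.
Proof.
have <- : #|[set A : {set 'I_n} | A \subset [set~ i] & #|A| == r]| = 'C(n.-1, r).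
  by rewrite cards_draws cardsC1 card_ord.
rewrite -[in RHS](card_ord n) -card_draws.
rewrite -(cardsID [set A : {set 'I_n} | i \in A] [set A : {set 'I_n} | #|A| == r]).
congr (_ + _)%N; apply: eq_card => A; rewrite !inE; first by rewrite andbC andbC.
by rewrite finset.subsetC finset.sub1set inE andbC.
Qed.

(* Each product over A is at least [1 - \sum_(i in A) t i]; summed over the
   r-subsets, every index is counted C(n,r) - C(n-1,r) times. *)
Lemma esym_gt (R : realFieldType) n r (k t : 'I_n -> R) :
  (0 < r <= n)%N -> (forall i, 0 <= t i) -> \sum_i t i < 1 ->
  (forall i, 1 - t i <= k i) ->
  'C(n.-1, r)%:R < \sum_(A : {set 'I_n} | #|A| == r) \prod_(i in A) k i.
Proof.
move=> /andP[r0 rn] t0 t1 hk.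
have ht i : 0 <= t i <= 1.
  rewrite t0 /=; apply: le_trans (ltW t1).
  by rewrite (bigD1 i) //= lerDl sumr_ge0.
have : \sum_(A : {set 'I_n} | #|A| == r) (1 - \sum_(i in A) t i) <=
       \sum_(A : {set 'I_n} | #|A| == r) \prod_(i in A) k i.
  apply: ler_sum => A _; apply: le_trans (prod_one_minus_ge A ht) _.
  apply: ler_prod => i _; rewrite hk andbT subr_ge0.
  by have /andP[] := ht i.
apply: lt_le_trans; rewrite big_split /= sumrN.
have -> : \sum_(A : {set 'I_n} | #|A| == r) \sum_(i in A) t i =
    \sum_i t i * ('C(n, r)%:R - 'C(n.-1, r)%:R).
  rewrite (exchange_big_dep xpredT) //=; apply: eq_bigr => i _.
  rewrite sumr_const -(card_draws_mem r i) natrD addrK mulr_natr.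
  by congr (_ *+ _); apply: eq_card => A; rewrite !inE.
have -> : \sum_(A : {set 'I_n} | #|A| == r) (1 : R) = 'C(n, r)%:R.
  rewrite sumr_const -[in RHS](card_ord n) -card_draws.
  by congr (_%:R); apply: eq_card => A; rewrite !inE.
rewrite -mulr_suml.
(* This strict inequality, from [0 < r <= n], makes the coefficient of [\sum_i t i] nonzero, so that
   [\sum_i t i < 1] yields a strict bound. *)
have hb : ('C(n.-1, r)%:R : R) < 'C(n, r)%:R.
  case: n rn {k t t0 t1 hk ht} => [|n] rn; first by case: r r0 rn.
  case: r r0 rn => // r _ rn.
  by rewrite binS ltr_nat -[ltnLHS]addn0 ltn_add2l bin_gt0.
nra.
Qed.

(** * Reduction of a symmetric form relative to a positive definite one *)

Section SimultaneousDiagonalization.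
Variable R : rcfType.

Lemma pos_form_det_neq0 n (G : 'M[R]_n) :
  (forall v : 'rV_n, v != 0 -> 0 < (v *m G *m v^T) 0 0) -> \det G != 0.
Proof.
move=> pG; apply/negP => /eqP/eqP/det0P[v v0 vG].
by have := pG v v0; rewrite vG mul0mx mxE ltxx.
Qed.

(** [W] is a basis of the kernel of [G *m v^T], which has dimension [n] because [v] is not
    isotropic. *)
Lemma orthogonal_complement n (G : 'M[R]_(1 + n)) (v : 'rV[R]_(1 + n)) :
  v *m G *m v^T = 1%:M -> exists W : 'M[R]_(n, 1 + n),
    W *m G *m v^T = 0 /\ col_mx v W \in unitmx.
Proof.
move=> vGv; pose K := kermx (G *m v^T).
have rk : \rank K = n.
  rewrite mxrank_ker; suff -> : \rank (G *m v^T) = 1%N by rewrite addKn.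
  apply/eqP; rewrite eqn_leq rank_leq_col lt0n mxrank_eq0.
  apply/eqP => GV0; move: vGv; rewrite -mulmxA GV0 mulmx0 => /matrixP/(_ 0 0).
  by rewrite !mxE eqxx => /esym/eqP; rewrite oner_eq0.
have [W WK Wf] : exists2 W : 'M[R]_(n, 1 + n), (W <= K)%MS & row_free W.
  have := eq_row_base K; have := row_base_free K.
  move: (row_base K); rewrite rk => W Wf WK.
  by exists W => //; rewrite WK.
have WGv : W *m G *m v^T = 0 by rewrite -mulmxA; apply/sub_kermxP.
exists W; split=> //; rewrite unitmxE unitfE; apply/negP => /det0P[u u0].
rewrite -[u]hsubmxK mul_row_col => uT.
(* Pairing the relation with [v] through [G] kills the part coming from [W]. *)
have a0 : lsubmx u = 0.
  have := congr1 (mulmx^~ (G *m v^T)) uT.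
  rewrite /= mul0mx mulmxDl -!mulmxA (mulmxA v) vGv (mulmxA W) WGv mulmx1 mulmx0.
  by rewrite addr0.
move: uT; rewrite a0 mul0mx add0r => /eqP; rewrite mulmx_free_eq0 // => /eqP b0.
by move: u0; rewrite -[u]hsubmxK a0 b0 row_mx0 eqxx.
Qed.

(** Induction on [n]: the root [k 0] of the pencil [X G - A] gives a generalized eigenvector, and
    its [G]-orthogonal complement carries a pencil with the remaining roots. A pencil is used
    because congruence only multiplies its determinant by a square constant. *)
Lemma simultaneous_diag_pencil n (G A : 'M[R]_n) (k : 'I_n -> R) :
  G^T = G -> A^T = A ->
  (forall v : 'rV_n, v != 0 -> 0 < (v *m G *m v^T) 0 0) ->
  \det ('X *: map_mx polyC G - map_mx polyC A) =
    (\det G)%:P * \prod_i ('X - (k i)%:P) ->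
  exists V : 'M[R]_n, V *m G *m V^T = 1%:M /\
    forall i, (V *m A *m V^T) i i = k i.
Proof.
elim: n G A k => [|n IH] G A k sG sA pG hdet.
  by exists 0; split=> [|[]//]; apply/matrixP => -[].
have [u u0 uk] : exists2 u : 'rV[R]_(1 + n), u != 0 & u *m (k 0 *: G - A) = 0.
  apply/det0P.
  have -> : k 0 *: G - A = map_mx (horner_eval (k 0))
      ('X *: map_mx polyC G - map_mx polyC A).
    by apply/matrixP => i j; rewrite !mxE /horner_eval !hornerE.
  rewrite det_map_mx hdet big_ord_recl /= !rmorphM /=.
  by rewrite {2}/horner_eval hornerXsubC subrr mul0r mulr0.
pose c := Num.sqrt ((u *m G *m u^T) 0 0).
have c0 : 0 < c by rewrite sqrtr_gt0 pG.
pose v : 'rV_(1 + n) := c^-1 *: u.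
have vGv : v *m G *m v^T = 1%:M.
  rewrite [LHS]mx11_scalar; congr (_%:M).
  rewrite /v linearZ /= -!scalemxAl -scalemxAr scalerA mxE.
  rewrite -[X in _ * X](@sqr_sqrtr R) ?(ltW (pG u u0)) // -/c.
  by field; rewrite gt_eqF.
have vk : v *m A = k 0 *: (v *m G).
  rewrite /v -!scalemxAl; move: uk; rewrite mulmxBr => /eqP; rewrite subr_eq0 => /eqP <-.
  by rewrite -scalemxAr scalerA mulrC -scalerA.
clearbody v.
have [W [WGv Tu]] := orthogonal_complement vGv.
pose T := col_mx v W.
pose G' := W *m G *m W^T; pose A' := W *m A *m W^T.
have TGT : T *m G *m T^T = block_mx 1%:M 0 0 G'.
  rewrite /T mul_col_mx tr_col_mx mul_col_row vGv WGv; congr block_mx.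
  by apply: trmx_inj; rewrite !trmx_mul trmxK sG mulmxA WGv trmx0.
(* Since [v *m A] is a multiple of [v *m G], being [G]-orthogonal to [v] implies being
   [A]-orthogonal to it, so both forms split along the same blocks. *)
have TAT : T *m A *m T^T = block_mx (k 0)%:M 0 0 A'.
  rewrite /T mul_col_mx tr_col_mx mul_col_row vk.
  have vW : v *m G *m W^T = 0.
    by apply: trmx_inj; rewrite !trmx_mul trmxK sG mulmxA WGv trmx0.
  have WA : W *m A *m v^T = 0.
    rewrite -mulmxA; have -> : A *m v^T = (v *m A)^T by rewrite trmx_mul sA.
    by rewrite vk linearZ /= trmx_mul sG -scalemxAr mulmxA WGv scaler0.
  by rewrite -!scalemxAl vGv vW WA scaler0 scalemx1.
have pG' (w : 'rV_n) : w != 0 -> 0 < (w *m G' *m w^T) 0 0.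
  move=> w0; have -> : w *m G' *m w^T = (w *m W) *m G *m (w *m W)^T.
    by rewrite trmx_mul !mulmxA.
  apply: pG; apply/eqP => wW; move/negP: w0; apply.
  have : row_mx 0 w *m T = 0 by rewrite mul_row_col mul0mx add0r.
  move/(congr1 (mulmx^~ (invmx T))); rewrite mulmxK // mul0mx => /eqP.
  by rewrite row_mx_eq0 => /andP[].
have dT : \det T != 0 by rewrite -unitfE -unitmxE.
have dG' : \det G' = (\det T) ^+ 2 * \det G.
  have := congr1 determinant TGT.
  by rewrite det_ublock det1 mul1r !det_mulmx det_tr => <-; ring.
have [V [VG VA]] : exists V : 'M[R]_n, V *m G' *m V^T = 1%:M /\
    forall i, (V *m A' *m V^T) i i = k (lift ord0 i).
  apply: IH => //.
  - by rewrite /G' !trmx_mul trmxK sG mulmxA.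
  - by rewrite /A' !trmx_mul trmxK sA mulmxA.
  have Xk0 : 'X - (k 0)%:P != 0 by rewrite polyXsubC_eq0.
  apply: (mulfI Xk0).
  (* The transformed pencil has its determinant computed twice: by blocks, and as the original one
     times [(\det T)^2]. *)
  have <- : \det (map_mx polyC T *m ('X *: map_mx polyC G - map_mx polyC A)
      *m (map_mx polyC T)^T) =
      ('X - (k 0)%:P) * \det ('X *: map_mx polyC G' - map_mx polyC A').
    rewrite mulmxBr mulmxBl -scalemxAr -scalemxAl map_trmx -!map_mxM TGT TAT.
    rewrite !map_block_mx !map_scalar_mx !map_mx0 scale_block_mx !scaler0.
    rewrite opp_block_mx add_block_mx !oppr0 !addr0 det_ublock; congr (_ * _).
    by rewrite det_mx11 !mxE !mulr1n mulr1.
  rewrite !det_mulmx det_tr hdet det_map_mx dG' big_ord_recl rmorphM rmorphXn.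
  by ring.
pose D : 'M[R]_(1 + n) := block_mx 1%:M 0 0 V.
have DE (B : 'M[R]_(1 + n)) (a : 'M[R]_1) B' : T *m B *m T^T = block_mx a 0 0 B' ->
    D *m T *m B *m (D *m T)^T = block_mx a 0 0 (V *m B' *m V^T).
  have -> : D *m T *m B *m (D *m T)^T = D *m (T *m B *m T^T) *m D^T.
    by rewrite trmx_mul !mulmxA.
  move=> ->.
  rewrite tr_block_mx !trmx0 trmx1 !mulmx_block !mulmx0 !mul0mx !addr0 !add0r.
  by rewrite !mul1mx mulmx1 !mul0mx.
exists (D *m T); split; first by rewrite (DE _ _ _ TGT) VG -scalar_mx_block.
move=> i; rewrite (DE _ _ _ TAT); case: (@split_ordP 1 n i) => j ->.
  by rewrite (@block_mxEul _ 1 n 1 n) ord1 mxE eqxx mulr1n; congr k; apply: val_inj.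
by rewrite (@block_mxEdr _ 1 n 1 n) VA; congr k; apply: val_inj.
Qed.

(** Since [(X - A G^-1) G = X G - A], the characteristic polynomial times [\det G] is the
    determinant of the pencil. *)
Lemma simultaneous_diag n (G A : 'M[R]_n) (k : 'I_n -> R) :
  G^T = G -> A^T = A ->
  (forall v : 'rV_n, v != 0 -> 0 < (v *m G *m v^T) 0 0) ->
  char_poly (A *m invmx G) = \prod_i ('X - (k i)%:P) ->
  exists V : 'M[R]_n, V *m G *m V^T = 1%:M /\
    forall i, (V *m A *m V^T) i i = k i.
Proof.
move=> sG sA pG hc; apply: simultaneous_diag_pencil => //.
have uG : G \in unitmx by rewrite unitmxE unitfE pos_form_det_neq0.
rewrite -hc mulrC -det_map_mx -det_mulmx /char_poly_mx mulmxBl mul_scalar_mx.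
by rewrite -map_mxM mulmxKV.
Qed.
End SimultaneousDiagonalization.

Local Open Scope classical_set_scope.
Local Open Scope ring_scope.

(** * Second derivatives *)

Lemma is_derive_along_line (R : realType) (V W : normedModType R) (g : V -> W)
    (x a : V) (t : R) (dg : W) :
  is_derive (x + t *: a) a g dg ->
  is_derive t 1 (fun s : R => g (x + s *: a)) dg.
Proof.
case=> dga gE.
have E : (fun h : R => h^-1 *: (((fun s : R => g (x + s *: a)) \o shift t) (h *: 1)
            - g (x + t *: a))) =
         (fun h : R => h^-1 *: ((g \o shift (x + t *: a)) (h *: a)
            - g (x + t *: a))).
  apply/funext => h /=; congr (_ *: (g _ - _)).
  by rewrite scalerDl [h *: 1]mulr1 addrCA.
by split; [rewrite /derivable /= E | rewrite -gE /derive /= E].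
Qed.

Lemma MVT_derivable (R : realType) (f df : R -> R) (h : R) : 0 <= h ->
  (forall s, 0 <= s <= h -> is_derive s 1 f (df s)) ->
  exists2 s, 0 <= s <= h & f h - f 0 = h * df s.
Proof.
move=> h0 fd; have [s||s] := @MVT_segment R f df 0 h h0.
- by rewrite in_itv /= => /andP[s0 sh]; apply: fd; rewrite !ltW.
- apply: derivable_within_continuous => s; rewrite in_itv /= => sh.
  by have [] := fd s sh.
- by rewrite in_itv /= subr0 => sh ->; exists s => //; rewrite mulrC.
Qed.

(** The mean value theorem is applied twice: along [a] to the increment of [g] by [h *: b], then
    along [b] to ['D_a g]. *)
Lemma second_difference (R : realType) (V : normedModType R) (g : V -> R)
    (x a b : V) (h : R) : 0 <= h ->
  (forall s t, 0 <= s <= h -> 0 <= t <= h ->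
     derivable g (x + s *: a + t *: b) a /\
     derivable ('D_a g) (x + s *: a + t *: b) b) ->
  exists s t, [/\ 0 <= s <= h, 0 <= t <= h &
    g (x + h *: a + h *: b) - g (x + h *: a) - (g (x + h *: b) - g x) =
    h * h * 'D_b ('D_a g) (x + s *: a + t *: b)].
Proof.
move=> h0 gd.
have h0h : 0 <= h <= h by rewrite h0 lexx.
have h00 : 0 <= (0 : R) <= h by rewrite lexx.
have [s|s sh E1] := @MVT_derivable R
    (fun s => g (x + h *: b + s *: a) - g (x + s *: a))
    (fun s => 'D_a g (x + s *: a + h *: b) - 'D_a g (x + s *: a)) h h0.
  move=> sh; apply: is_deriveB; apply: is_derive_along_line.
    by rewrite addrAC; apply: derivableP; exact: (gd s h sh h0h).1.
  by apply: derivableP; have := (gd s 0 sh h00).1; rewrite scale0r addr0.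
have [t|t th E2] := @MVT_derivable R
    (fun t => 'D_a g (x + s *: a + t *: b))
    (fun t => 'D_b ('D_a g) (x + s *: a + t *: b)) h h0.
  move=> th; apply: (@is_derive_along_line _ _ _ ('D_a g)).
  by apply: derivableP; exact: (gd s t sh th).2.
exists s, t; split=> //.
move: E1 E2; rewrite !scale0r !addr0 => E1 E2.
by rewrite [x + h *: a + _]addrAC E1 E2 mulrA.
Qed.

(* Both sides are limits of the same second difference divided by [h * h]. *)
Lemma derive_comm (R : realType) (V : normedModType R) (g : V -> R) (x a b : V) :
  (\forall y \near x, [/\ derivable g y a, derivable g y b,
      derivable ('D_a g) y b & derivable ('D_b g) y a]) ->
  {for x, continuous ('D_b ('D_a g))} -> {for x, continuous ('D_a ('D_b g))} ->
  'D_b ('D_a g) x = 'D_a ('D_b g) x.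
Proof.
move=> gd c1 c2; apply/eqP; rewrite -subr_eq0 -normr_le0; apply/ler_addgt0Pl => e e0.
rewrite addr0.
have : \forall y \near x, [/\ derivable g y a /\ derivable ('D_a g) y b,
      derivable g y b /\ derivable ('D_b g) y a,
      `|'D_b ('D_a g) x - 'D_b ('D_a g) y| < e / 2 &
      `|'D_a ('D_b g) x - 'D_a ('D_b g) y| < e / 2].
  have e2 : 0 < e / 2 by rewrite divr_gt0.
  move/cvgrPdist_lt : c1 => /(_ _ e2) c1; move/cvgrPdist_lt : c2 => /(_ _ e2) c2.
  apply: filterS3 gd c1 c2 => y [g1 g2 g3 g4] c1y c2y.
  exact: And4 (conj g1 g3) (conj g2 g4) c1y c2y.
move=> /nbhs_normP[d /= d0 xd].
(* This [h] keeps the parallelogram spanned by [h *: a] and [h *: b] inside the ball of radius [d];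
   the summand 1 covers [a = b = 0]. *)
pose h := d / (2 * (`|a| + `|b| + 1)).
have N0 : 0 < `|a| + `|b| + 1 by rewrite ltr_wpDl ?addr_ge0.
have h0 : 0 < h by rewrite divr_gt0 // mulr_gt0.
have near_h s t : 0 <= s <= h -> 0 <= t <= h -> `|x - (x + s *: a + t *: b)| < d.
  move=> /andP[s0 sh] /andP[t0 th]; rewrite -addrA opprD addNKr normrN.
  apply: le_lt_trans (ler_normD _ _) _; rewrite !normrZ !ger0_norm //.
  have dE : h * (2 * (`|a| + `|b| + 1)) = d by rewrite divfK // mulf_neq0 // gt_eqF.
  have sa : s * `|a| <= h * `|a| by rewrite ler_wpM2r.
  have tb : t * `|b| <= h * `|b| by rewrite ler_wpM2r.
  apply: le_lt_trans (lerD sa tb) _; rewrite -mulrDr -dE ltr_pM2l //.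
  by have := addr_ge0 (normr_ge0 a) (normr_ge0 b); lra.
have [|s [t [sh th E1]]] := @second_difference R V g x a b h (ltW h0).
  by move=> s t sh th; have [] := xd _ (near_h s t sh th).
(* The second difference is symmetric in [a] and [b]; exchanging them expresses it by the other
   mixed derivative, at another point of the parallelogram. *)
have [|s' [t' [sh' th' E2]]] := @second_difference R V g x b a h (ltW h0).
  move=> s' t' sh' th'; rewrite -addrA (addrC (_ *: b)) addrA.
  by have [] := xd _ (near_h t' s' th' sh').
have E : 'D_b ('D_a g) (x + s *: a + t *: b) = 'D_a ('D_b g) (x + t' *: a + s' *: b).
  have hh : h * h != 0 by rewrite mulf_neq0 // gt_eqF.
  have swap (p q u w : R) : p - q - (u - w) = p - u - (q - w) by ring.
  move: E2; rewrite (addrAC x (h *: b)) (addrAC x (s' *: b)) swap E1.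
  by move/(mulfI hh).
have [_ _ A1 _] := xd _ (near_h s t sh th).
have [_ _ _ A2] := xd _ (near_h t' s' th' sh').
rewrite -(subrKA ('D_b ('D_a g) (x + s *: a + t *: b))).
apply: le_trans (ler_normD _ _) _; rewrite {2}E [X in _ + X]distrC.
by rewrite (splitr e); exact: lerD (ltW A1) (ltW A2).
Qed.

(** If [c > 0], then [f' s / s] is positive for small [s > 0], and the mean value theorem produces a
    value above [f 0]. *)
Lemma second_derivative_test (R : realType) (f f' : R -> R) (c : R) :
  (\forall s \near (0 : R), is_derive (s : R) (1 : R) f (f' s)) ->
  is_derive (0 : R) 1 f' c ->
  (\forall s \near (0 : R), f s <= f 0) -> f' 0 = 0 /\ c <= 0.
Proof.
move=> fd f'd fmax.
have /nbhs_normP[d /= d0 xd] : \forall s \near (0 : R),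
    is_derive (s : R) (1 : R) f (f' s) /\ f s <= f 0.
  by near=> s; split; near: s.
have xd' (s : R) : `|s| < d -> is_derive s 1 f (f' s) /\ f s <= f 0.
  by move=> sd; apply: xd; rewrite /ball_ /= sub0r normrN.
have f'0 : f' 0 = 0.
  have sd (s : R) : s \in `](- d), d[%R -> `|s| < d by rewrite in_itv /= -ltr_norml.
  have dd : - d <= d by rewrite ge0_cp ?ltW.
  have d00 : 0 \in `](- d), d[%R by rewrite in_itv /= oppr_lt0 d0.
  have [_ D0] : is_derive (0 : R) 1 f 0.
    apply: (derive1_at_max dd _ d00) => s /sd sd'; first by case: (xd' s sd') => -[].
    by case: (xd' s sd').
  by have [|[_ <-] _] := xd' 0; first rewrite normr0.
split=> //; rewrite leNgt; apply/negP => c0.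
have cv : h^-1 *: (f' (h *: 1 + 0) - f' 0) @[h --> 0^'] --> c.
  by case: f'd => f'd <-; exact: f'd.
have [e /= e0 ed] := cvgr_gt _ cv _ c0.
pose h := Num.min d e / 2.
have m0 : 0 < Num.min d e by rewrite lt_min d0.
have h0 : 0 < h by rewrite divr_gt0.
have [hd he] : h < d /\ h < e.
  have : h < Num.min d e by rewrite /h; lra.
  by rewrite lt_min => /andP.
have hs (s : R) : 0 <= s <= h -> `|s| < d.
  by move=> /andP[s0 sh]; rewrite ger0_norm // (le_lt_trans sh).
have [s|s|s] := @MVT R f f' 0 h h0.
- by rewrite in_itv /= => /andP[s0 sh]; case: (xd' s) => //; rewrite hs // !ltW.
- apply: derivable_within_continuous => t; rewrite in_itv /= => th.
  by have [[]] := xd' _ (hs t th).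
rewrite in_itv /= subr0 => /andP[s0 sh] E.
have : 0 < s^-1 *: (f' (s *: 1 + 0) - f' 0).
  apply: ed; last by rewrite gt_eqF.
  by rewrite /ball_ /= sub0r normrN gtr0_norm // (lt_trans sh).
rewrite addr0 f'0 subr0 [s *: 1]mulr1 => f's.
have f's0 : 0 < f' s by rewrite -(@pmulr_rgt0 _ (s^-1)) ?invr_gt0.
have hh : 0 <= h <= h by rewrite lexx ltW.
have [_] := xd' _ (hs h hh).
by apply/negP; rewrite -ltNge -subr_gt0 E mulr_gt0.
Unshelve. all: by end_near. Qed.

(** * Rules for directional derivatives of scalar expressions *)

Section PointwiseDerivatives.
Variables (R : realType) (V : normedModType R).

Lemma is_derive_coord (m n : nat) (F : V -> 'M[R]_(m, n)) x v dF i j :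
  is_derive x v F dF -> is_derive x v (fun y => F y i j) (dF i j).
Proof.
case=> dF1 <-; rewrite derive_mx // mxE; apply: derivableP.
by move/derivable_mxP : dF1.
Qed.

Lemma is_derive_mul (f g : V -> R) x v df dg :
  is_derive x v f df -> is_derive x v g dg ->
  is_derive x v (fun y => f y * g y) (df * g x + f x * dg).
Proof.
move=> fd gd; apply: is_derive_eq (is_deriveM fd gd) _.
by rewrite addrC mulrC.
Qed.

Lemma is_derive_inv (f : V -> R) x v df : f x != 0 ->
  is_derive x v f df -> is_derive x v (fun y => (f y)^-1) (- df / f x ^+ 2).
Proof.
move=> f0 [fd <-]; split; first exact: derivableV.
by rewrite deriveV // mulNr mulrC scaleNr.
Qed.

Lemma is_derive_sum_fun n (f : 'I_n -> V -> R) x v (df : 'I_n -> R) :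
  (forall i, is_derive x v (f i) (df i)) ->
  is_derive x v (fun y => \sum_i f i y) (\sum_i df i).
Proof.
move=> fd; have -> : (fun y => \sum_i f i y) = \sum_i f i.
  by apply/funext => y; rewrite fct_sumE.
exact: is_derive_sum.
Qed.

End PointwiseDerivatives.

(** * Second directional derivatives of maps of class C^2 *)

Section SecondPartials.
Variables (R : realType) (m p : nat) (F : 'rV[R]_m -> 'rV[R]_p).
Variables (U : set 'rV[R]_m) (x : 'rV[R]_m).
Hypotheses (oU : open U) (Ux : U x) (F2 : Ck_on 2 U F).

Lemma derive_sum_partial (W : normedModType R) (g : 'rV[R]_m -> W) y v :
  differentiable g y -> 'D_v g y = \sum_i v 0 i *: partial i g y.
Proof.
move=> gd; rewrite deriveE // {1}[v]row_sum_delta linear_sum.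
by apply: eq_bigr => i _; rewrite linearZ /partial deriveE.
Qed.

Lemma Ck2_differentiable y : U y -> differentiable F y.
Proof. by case: F2 => + _; exact. Qed.

Lemma Ck2_derive_differentiable v y : U y -> differentiable ('D_v F) y.
Proof. by case: F2 => _ /(_ v)[+ _]; exact. Qed.

Lemma Ck2_derive2_continuous v w y : U y -> {for y, continuous ('D_w ('D_v F))}.
Proof. by move=> Uy; case: F2 => _ F2v; exact: ((F2v v).2 w y Uy). Qed.

Lemma nbhs_domain : \forall y \near x, U y.
Proof. exact: open_nbhs_nbhs. Qed.

Lemma derive2_sum_partial v : 'D_v ('D_v F) x =
  \sum_i \sum_j (v 0 i * v 0 j) *: partial i (partial j F) x.
Proof.
rewrite derive_sum_partial; last exact: Ck2_derive_differentiable.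
apply: eq_bigr => i _.
(* The first-order expansion holds on a neighbourhood with constant coefficients [v 0 j], so it can
   be differentiated again. *)
have dE : \forall y \near x, 'D_v F y = (\sum_j v 0 j *: partial j F) y.
  apply: filterS nbhs_domain => y Uy; rewrite fct_sumE.
  exact: derive_sum_partial (Ck2_differentiable Uy).
have pd j : derivable (partial j F) x (delta_mx 0 i).
  by apply: diff_derivable; exact: Ck2_derive_differentiable.
rewrite {1}/partial (near_eq_derive _ dE) derive_sum; last first.
  by move=> j; apply: derivableZ; exact: pd.
rewrite scaler_sumr; apply: eq_bigr => j _.
by rewrite deriveZ ?scalerA //; exact: pd.
Qed.

Lemma derive_coord v y c : U y -> 'D_v (fun z => F z 0 c) y = 'D_v F y 0 c.
Proof.
move=> Uy; apply: derive_val; apply: is_derive_coord; apply: derivableP.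
exact: diff_derivable (Ck2_differentiable Uy).
Qed.

(** [derive_comm] is applied to each coordinate function. First derivatives of coordinates agree
    with coordinates of derivatives only on [U], hence the passage through neighbourhoods. *)
Lemma partial_comm i j : partial i (partial j F) x = partial j (partial i F) x.
Proof.
apply/matrixP => r c; rewrite (ord1 r) {r}.
pose f (z : 'rV[R]_m) : R := F z 0 c.
have d1 v y : U y -> 'D_v f y = 'D_v F y 0 c by exact: derive_coord.
have near1 v y : U y -> \forall z \near y, 'D_v F z 0 c = 'D_v f z.
  move=> Uy; have : \forall z \near y, U z by exact: open_nbhs_nbhs.
  by apply: filterS => z Uz; rewrite d1.
have D2 v w y : U y -> is_derive y w ('D_v f) ('D_w ('D_v F) y 0 c).
  move=> Uy; apply: near_eq_is_derive (near1 v y Uy) _.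
  apply: is_derive_coord; apply: derivableP.
  exact: diff_derivable (Ck2_derive_differentiable _ Uy).
have d2 v w y : U y -> 'D_w ('D_v f) y = 'D_w ('D_v F) y 0 c.
  by move=> Uy; have [_ ->] := D2 v w y Uy.
have c2 v w : {for x, continuous ('D_w ('D_v f))}.
  have near2 : \forall z \near x, 'D_w ('D_v F) z 0 c = 'D_w ('D_v f) z.
    by apply: filterS nbhs_domain => z Uz; rewrite d2.
  rewrite /prop_for /continuous_at d2 //.
  apply: cvg_trans (near_eq_cvg near2) _.
  exact: (@continuous_comp _ _ _ ('D_w ('D_v F)) (fun M : 'rV[R]_p => M 0 c) x
    (@Ck2_derive2_continuous v w x Ux) (@coord_continuous R 1 p 0 c _)).
apply: etrans (esym (d2 (delta_mx 0 j) (delta_mx 0 i) x Ux)) _.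
apply: etrans _ (d2 (delta_mx 0 i) (delta_mx 0 j) x Ux).
apply: derive_comm (c2 _ _) (c2 _ _).
apply: filterS nbhs_domain => y Uy.
have df v : derivable f y v.
  have /derivable_mxP := @diff_derivable _ _ _ F y v (Ck2_differentiable Uy).
  by move=> h; exact: h.
by split; [exact: df|exact: df
  |case: (D2 (delta_mx 0 j) (delta_mx 0 i) y Uy) => h _; exact: h
  |case: (D2 (delta_mx 0 i) (delta_mx 0 j) y Uy) => h _; exact: h].
Qed.

End SecondPartials.

(** * The conformal factor and its Levi-Civita connection *)

(* Locked because rewriting with [mulr_sumr] would otherwise match its body. *)
HB.lock Definition hdot (R : realType) (n : nat) (u v : 'rV[R]_(n + 1)) : R :=
  \sum_(i < n) u 0 (lshift 1 i) * v 0 (lshift 1 i).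
Arguments hdot {R n} u v.

Section HorizontalProduct.
Variables (R : realType) (n : nat).
Implicit Types u v w y : 'rV[R]_(n + 1).

Definition vcoord u : R := u 0 (rshift n 0).

Definition conf y : R := 2 / (1 - hdot y y).

(** The function [Phi] of the overview, equal to [cosh d(0, y) - t] up to the constant 1. *)
Definition cosh_height y : R := conf y - vcoord y.

Lemma hdotC u v : hdot u v = hdot v u.
Proof. by rewrite hdot.unlock; apply: eq_bigr => i _; rewrite mulrC. Qed.

Lemma hdotDl u v w : hdot (u + v) w = hdot u w + hdot v w.
Proof. by rewrite hdot.unlock -big_split; apply: eq_bigr => i _; rewrite mxE mulrDl. Qed.

Lemma hdotZl a u w : hdot (a *: u) w = a * hdot u w.
Proof. by rewrite hdot.unlock mulr_sumr; apply: eq_bigr => i _; rewrite mxE mulrA. Qed.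

Lemma hdot_ge0 u : 0 <= hdot u u.
Proof. by rewrite hdot.unlock; apply: sumr_ge0 => i _; rewrite -expr2 sqr_ge0. Qed.

Lemma sqnorm_lsubmx y : sqnorm (lsubmx y) = hdot y y.
Proof. by rewrite hdot.unlock; apply: eq_bigr => i _; rewrite mxE expr2. Qed.

Lemma HnxRE y : HnxR R n y <-> hdot y y < 1.
Proof. by rewrite /HnxR /hyperbolic_ball /= sqnorm_lsubmx. Qed.

Lemma is_derive_hdot (V : normedModType R) (f g : V -> 'rV[R]_(n + 1)) (x a : V) df dg :
  is_derive x a f df -> is_derive x a g dg ->
  is_derive x a (fun z => hdot (f z) (g z)) (hdot df (g x) + hdot (f x) dg).
Proof.
move=> fd gd; rewrite hdot.unlock -big_split /=; apply: is_derive_sum_fun => i.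
by apply: is_derive_mul; exact: is_derive_coord.
Qed.

(** The quotient rule gives [4 <f, df> / (1 - |f|^2)^2], which is [l^2 <f, df>]. *)
Lemma is_derive_conf (V : normedModType R) (f : V -> 'rV[R]_(n + 1)) (x a : V) df :
  hdot (f x) (f x) < 1 -> is_derive x a f df ->
  is_derive x a (fun z => conf (f z)) (conf (f x) ^+ 2 * hdot (f x) df).
Proof.
move=> f1 fd.
have d0 : 1 - hdot (f x) (f x) != 0 by rewrite subr_eq0 gt_eqF.
have dd : is_derive x a (fun z => 1 - hdot (f z) (f z))
    (0 - (hdot df (f x) + hdot (f x) df)).
  exact: is_deriveB (is_derive_cst (1 : R) x a) (is_derive_hdot fd fd).
have cd := is_derive_mul (is_derive_cst (2 : R) x a) 
  (@is_derive_inv _ _ (fun z => 1 - hdot (f z) (f z)) _ _ _ d0 dd).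
apply: (is_derive_eq cd); rewrite /conf (hdotC df) /=; by field.
Qed.

End HorizontalProduct.

(** The second derivative test along the curve [s |-> F (x + s v)]. The formulas are Euclidean; the
    Christoffel terms enter with [second_formE]. *)
Lemma cosh_height_critical (R : realType) (n m : nat) (F : 'rV[R]_m -> 'rV[R]_(n + 1))
    (U : set 'rV[R]_m) (x v : 'rV[R]_m) :
  open U -> U x -> Ck_on 2 U F ->
  (forall y, U y -> hdot (F y) (F y) < 1) ->
  (forall y, U y -> cosh_height (F y) <= cosh_height (F x)) ->
  let l := conf (F x) in let X := 'D_v F x in let Q := 'D_v ('D_v F) x in
  l ^+ 2 * hdot (F x) X - vcoord X = 0 /\
  l ^+ 2 * hdot (F x) Q - vcoord Q + 2 * l ^+ 3 * hdot (F x) X ^+ 2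
    + l ^+ 2 * hdot X X <= 0.
Proof.
move=> oU Ux [F1 /(_ v)[F2 _]] F_in F_max l X Q.
have nearU : \forall s \near (0 : R), U (x + s *: v).
  have cl : {for (0 : R), continuous (fun s : R => x + s *: v)}.
    by apply: continuousD; [exact: cst_continuous|exact: scalel_continuous].
  by apply: cl; apply: open_nbhs_nbhs; rewrite scale0r addr0.
pose F' := 'D_v F.
have [] := @second_derivative_test R (fun s => cosh_height (F (x + s *: v)))
  (fun s => conf (F (x + s *: v)) ^+ 2 * hdot (F (x + s *: v)) (F' (x + s *: v))
            - vcoord (F' (x + s *: v)))
  (l ^+ 2 * hdot (F x) Q - vcoord Q + 2 * l ^+ 3 * hdot (F x) X ^+ 2
    + l ^+ 2 * hdot X X).
- apply: filterS nearU => s Us.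
  have dF : is_derive (s : R) (1 : R) (fun s : R => F (x + s *: v)) (F' (x + s *: v)).
    by apply: is_derive_along_line; apply: derivableP; apply: diff_derivable; exact: F1.
  exact: is_deriveB (is_derive_conf (F_in _ Us) dF) (is_derive_coord 0 (rshift n 0) dF).
- have dF : is_derive (0 : R) (1 : R) (fun s : R => F (x + s *: v)) X.
    apply: is_derive_along_line; rewrite scale0r addr0.
    by apply: derivableP; apply: diff_derivable; exact: F1.
  have dF' : is_derive (0 : R) (1 : R) (fun s : R => F' (x + s *: v)) Q.
    apply: is_derive_along_line; rewrite scale0r addr0.
    by apply: derivableP; apply: diff_derivable; exact: F2.
  have x0 : x + 0 *: v = x by rewrite scale0r addr0.
  have Fx0 : hdot (F (x + 0 *: v)) (F (x + 0 *: v)) < 1 by rewrite x0; exact: F_in.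
  have dl := is_derive_conf Fx0 dF.
  have cd := is_deriveB (is_derive_mul (is_derive_mul dl dl) (is_derive_hdot dF dF'))
    (is_derive_coord 0 (rshift n 0) dF').
  apply: (is_derive_eq cd); rewrite x0 -/l -/X -/(vcoord Q) (_ : F' x = X) //.
  by ring.
- apply: filterS nearU => s /F_max; rewrite scale0r addr0; exact: id.
by rewrite scale0r addr0.
Qed.

(** * The product metric and its Christoffel symbols *)

Section ProductMetric.
Variables (R : realType) (n : nat).
Implicit Types u v w y : 'rV[R]_(n + 1).
Local Notation g := (HnxR_metric R n).
Local Notation e := (delta_mx 0).

Lemma hdot_suml (I : finType) (c : I -> R) (f : I -> 'rV[R]_(n + 1)) w :
  hdot (\sum_i c i *: f i) w = \sum_i c i * hdot (f i) w.
Proof.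
elim/big_ind2: _ => [|u a v b <- <-|i _]; last exact: hdotZl.
  by rewrite -(scale0r 0) hdotZl mul0r.
exact: hdotDl.
Qed.

Lemma hdot_delta u w : \sum_b u 0 b * hdot w (e b) = hdot w u.
Proof.
rewrite [u in RHS]row_sum_delta hdotC hdot_suml.
by apply: eq_bigr => i _; rewrite hdotC.
Qed.

Lemma inner_HnxR y u v :
  inner g y u v = conf y ^+ 2 * hdot u v + vcoord u * vcoord v.
Proof.
have hE w1 w2 : hdot w1 w2 = (lsubmx w1 *m (lsubmx w2)^T) 0 0.
  by rewrite hdot.unlock mxE; apply: eq_bigr => i _; rewrite !mxE.
have vE w1 w2 : vcoord w1 * vcoord w2 = (rsubmx w1 *m (rsubmx w2)^T) 0 0.
  by rewrite mxE big_ord1 !mxE.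
rewrite hE vE /inner /HnxR_metric /hyperbolic_metric sqnorm_lsubmx -/(conf y).
rewrite -{1}[u]hsubmxK -{1}[v]hsubmxK mul_row_block tr_row_mx mul_row_col.
by rewrite !mulmx0 addr0 add0r mulmx1 mul_mx_scalar -scalemxAl !mxE.
Qed.

Lemma innerE y u v : inner g y u v = \sum_a (u *m g y) 0 a * v 0 a.
Proof. by rewrite /inner mxE; apply: eq_bigr => i _; rewrite [v^T _ _]mxE. Qed.

Lemma HnxR_metricE y d c :
  g y d c = conf y ^+ 2 * hdot (e d) (e c) + vcoord (e d) * vcoord (e c).
Proof. by rewrite -inner_HnxR /inner -rowE trmx_delta -colE !mxE. Qed.

Lemma HnxR_metric_sym y : (g y)^T = g y.
Proof.
by apply/matrixP => i j; rewrite mxE !HnxR_metricE hdotC [vcoord _ * _]mulrC.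
Qed.

Lemma innerC y u v : inner g y u v = inner g y v u.
Proof. by rewrite !inner_HnxR hdotC [vcoord _ * _]mulrC. Qed.

Lemma conf_ge2 y : hdot y y < 1 -> 2 <= conf y.
Proof.
move=> y1; rewrite /conf ler_pdivlMr ?subr_gt0 //.
by have := hdot_ge0 y; lra.
Qed.

Lemma conf_hdot y : hdot y y < 1 -> conf y * hdot y y = conf y - 2.
Proof.
by move=> y1; rewrite /conf; field; rewrite subr_eq0 gt_eqF.
Qed.

Lemma HnxR_metric_unit y : hdot y y < 1 -> g y \in unitmx.
Proof.
move=> /conf_ge2 c2; rewrite unitmxE unitfE det_ublock det1 mulr1.
rewrite /hyperbolic_metric sqnorm_lsubmx -/(conf y) det_scalar.
by rewrite !expf_neq0 // gt_eqF // (lt_le_trans _ c2).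
Qed.

Lemma partial_HnxR_metric y b d c : hdot y y < 1 ->
  partial b (fun z => g z d c) y =
  2 * conf y ^+ 3 * hdot y (e b) * hdot (e d) (e c).
Proof.
move=> y1; have -> : (fun z => g z d c) = (fun z =>
    conf z * conf z * hdot (e d) (e c) + vcoord (e d) * vcoord (e c)).
  by apply/funext => z; rewrite HnxR_metricE expr2.
have dc := is_derive_conf y1 (is_derive_id y (e b)).
have d1 := is_derive_mul (is_derive_mul dc dc)
  (is_derive_cst (hdot (e d) (e c)) y (e b)).
have [_ d2] := is_deriveD d1 (is_derive_cst (vcoord (e d) * vcoord (e c)) y (e b)).
apply: etrans d2 _ => /=.
by rewrite addr0 mulr0 addr0; ring.
Qed.

(** Pairing with [w] through the metric lowers the upper index and cancels the inverse metric. Only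
    horizontal products remain, as the vertical factor is flat. *)
Lemma christoffel_contract y w (X Y : 'rV[R]_(n + 1)) : hdot y y < 1 ->
  \sum_a (w *m g y) 0 a *
    (\row_a \sum_b \sum_c christoffel g y a b c * X 0 b * Y 0 c) 0 a =
  conf y ^+ 3 * (hdot y X * hdot w Y + hdot y Y * hdot w X
                 - hdot y w * hdot X Y).
Proof.
move=> y1.
(* Up to the factor [conf y ^+ 3], these are the Christoffel symbols of the first kind. *)
pose G d b c := hdot y (e b) * hdot (e d) (e c) + hdot y (e c) * hdot (e d) (e b)
  - hdot y (e d) * hdot (e b) (e c).
have chE a b c : christoffel g y a b c =
    conf y ^+ 3 * \sum_d invmx (g y) a d * G d b c.
  rewrite /christoffel !mulr_sumr; apply: eq_bigr => d _.
  by rewrite !partial_HnxR_metric // /G; field.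
have wE d : \sum_a (w *m g y) 0 a * invmx (g y) a d = w 0 d.
  by rewrite -[in RHS](mulmxK (HnxR_metric_unit y1) w) mxE.
have sE b c : \sum_a (w *m g y) 0 a * christoffel g y a b c =
    conf y ^+ 3 * (hdot y (e b) * hdot w (e c) + hdot y (e c) * hdot w (e b)
                   - hdot y w * hdot (e b) (e c)).
  under eq_bigr do rewrite chE mulrCA mulr_sumr.
  rewrite -mulr_sumr exchange_big /=; congr (_ * _).
  under eq_bigr do (under eq_bigr do rewrite mulrA; rewrite -mulr_suml wE /G).
  have wd z : \sum_d w 0 d * hdot (e d) z = hdot w z.
    by rewrite hdotC -hdot_delta; apply: eq_bigr => d _; rewrite hdotC.
  rewrite -(wd (e b)) -(wd (e c)) -(hdot_delta w y) !mulr_sumr mulr_suml.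
  by rewrite -sumrN -!big_split /=; apply: eq_bigr => d _; ring.
under eq_bigr do rewrite mxE mulr_sumr.
rewrite exchange_big /=.
transitivity (\sum_b \sum_c (X 0 b * Y 0 c) *
    \sum_a (w *m g y) 0 a * christoffel g y a b c).
  apply: eq_bigr => b _; under eq_bigr do rewrite mulr_sumr.
  rewrite exchange_big; apply: eq_bigr => c _; rewrite mulr_sumr.
  by apply: eq_bigr => a _; ring.
under eq_bigr do under eq_bigr do rewrite sE.
transitivity (\sum_b X 0 b * (conf y ^+ 3 * (hdot y (e b) * hdot w Y
    + hdot y Y * hdot w (e b) - hdot y w * hdot (e b) Y))).
  apply: eq_bigr => b _; rewrite -(hdot_delta Y w) -(hdot_delta Y y).
  rewrite -(hdot_delta Y (e b)) !mulr_sumr mulr_suml -sumrN -!big_split /= !mulr_sumr.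
  by apply: eq_bigr => c _; ring.
rewrite [hdot X Y]hdotC -(hdot_delta X w) -(hdot_delta X y) -(hdot_delta X Y).
rewrite mulr_suml !mulr_sumr -sumrN -!big_split /= !mulr_sumr.
by apply: eq_bigr => b _; rewrite (hdotC (e b) Y); ring.
Qed.

End ProductMetric.

(** * The touching point *)

(** By rank-nullity the kernel of a full-rank matrix with one more column than rows is a line. *)
Lemma kernel_line (K : fieldType) m (A : 'M[K]_(m, m + 1)) (u v : 'rV[K]_(m + 1)) :
  row_free A -> A *m u^T = 0 -> A *m v^T = 0 -> u != 0 ->
  exists c, v = c *: u.
Proof.
move=> Af Au Av u0.
have inker (w : 'rV[K]_(m + 1)) : A *m w^T = 0 -> (w <= kermx A^T)%MS.
  by move=> Aw; apply/sub_kermxP; apply: trmx_inj; rewrite trmx_mul trmxK Aw trmx0.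
apply/sub_rVP; apply: submx_trans (inker v Av) _.
rewrite -(mxrank_leqif_sup (inker u Au)) mxrank_ker mxrank_tr (eqP Af).
by rewrite rank_rV u0 addKn.
Qed.

Lemma mx_quad (K : comNzRingType) m (S : 'M[K]_m) (v : 'rV[K]_m) :
  (v *m S *m v^T) 0 0 = \sum_i \sum_j v 0 i * v 0 j * S i j.
Proof.
rewrite mxE exchange_big /=; apply: eq_bigr => j _; rewrite !mxE mulr_suml.
by apply: eq_bigr => i _; rewrite mulrAC.
Qed.

Lemma inner_row (R : realType) (p q m : nat) (g : metric_field R m) y
    (A : 'M[R]_(p, m)) (B : 'M[R]_(q, m)) i j :
  inner g y (row i A) (row j B) = (A *m g y *m B^T) i j.
Proof.
by rewrite /inner -row_mul !mxE; apply: eq_bigr => k _; rewrite !mxE.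
Qed.

Lemma innerZl (R : realType) (m : nat) (g : metric_field R m) y c u v :
  inner g y (c *: u) v = c * inner g y u v.
Proof. by rewrite /inner -!scalemxAl mxE. Qed.

Lemma inner_suml (R : realType) (m : nat) (g : metric_field R m) y (J : finType)
    (f : J -> 'rV[R]_m) v :
  inner g y (\sum_j f j) v = \sum_j inner g y (f j) v.
Proof. by rewrite /inner !mulmx_suml summxE. Qed.

(** Sums the right-hand side of [second_formE] against [v]: there [s] is [l^3], [c] is [|F|^2], [a]
    holds the products of [F] with its partials, and [H] those between partials. *)
Lemma sum_quad (K : comPzRingType) (J : finType) (v a : J -> K) (G H : J -> J -> K) s c :
  \sum_i \sum_j v i * v j * (G i j + s * (2 * a i * a j - c * H i j)) =
  \sum_i \sum_j v i * v j * G i j + s * (2 * (\sum_i v i * a i) ^+ 2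
    - c * \sum_i \sum_j v i * v j * H i j).
Proof.
rewrite expr2 mulr_suml !mulr_sumr -sumrN -big_split mulr_sumr -big_split /=.
apply: eq_bigr => i _.
rewrite !mulr_sumr -sumrN -big_split mulr_sumr -big_split /=.
by apply: eq_bigr => j _; ring.
Qed.

Section HeightGradient.
Variables (R : realType) (n : nat).
Local Notation g := (HnxR_metric R n).

(** The Riemannian gradient of [cosh_height]: the factor [l^2] of its differential cancels against
    the metric, leaving the position vector as horizontal part. *)
Definition grad_height (y : 'rV[R]_(n + 1)) : 'rV[R]_(n + 1) :=
  row_mx (lsubmx y) (- 1%:M).

Lemma hdot_grad y X : hdot (grad_height y) X = hdot y X.
Proof. by rewrite hdot.unlock; apply: eq_bigr => i _; rewrite row_mxEl mxE. Qed.

Lemma vcoord_grad y : vcoord (grad_height y) = - 1.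
Proof. by rewrite /vcoord row_mxEr !mxE eqxx. Qed.

Lemma inner_grad y X :
  inner g y (grad_height y) X = conf y ^+ 2 * hdot y X - vcoord X.
Proof. by rewrite inner_HnxR hdot_grad vcoord_grad mulN1r. Qed.

(** By [conf_hdot], [l^2 |y|^2 + 1 = l (l - 2) + 1]. *)
Lemma inner_grad_grad y : hdot y y < 1 ->
  inner g y (grad_height y) (grad_height y) = (conf y - 1) ^+ 2.
Proof.
move=> y1; rewrite inner_grad hdotC hdot_grad vcoord_grad.
by rewrite expr2 -mulrA conf_hdot //; ring.
Qed.

End HeightGradient.

Section TouchingPoint.
Variables (R : realType) (n : nat).
Local Notation g := (HnxR_metric R n).
Variables (F nu : 'rV[R]_n -> 'rV[R]_(n + 1)) (U : set 'rV[R]_n) (x : 'rV[R]_n).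
Hypotheses (oU : open U) (Ux : U x) (F2 : Ck_on 2 U F).
Hypothesis F_in : forall y, U y -> hdot (F y) (F y) < 1.
Hypothesis F_max : forall y, U y -> cosh_height (F y) <= cosh_height (F x).
Hypothesis J_free : row_free (jacobian F x).
Hypothesis nu_unit : inner g (F x) (nu x) (nu x) = 1.
Hypothesis nu_orth : forall i, inner g (F x) (partial i F x) (nu x) = 0.

Local Notation J := (jacobian F x).
Local Notation I := (first_form g F x).
Local Notation II := (second_form g F nu x).
Local Notation l := (conf (F x)).

Lemma row_jacobian i : row i J = partial i F x.
Proof.
by rewrite rowE /partial deriveEjacobian //; exact: Ck2_differentiable F2 _ Ux.
Qed.

Lemma first_formE : I = J *m g (F x) *m J^T.
Proof. by apply/matrixP => i j; rewrite mxE -!row_jacobian inner_row. Qed.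

Lemma jacobian_normal X : (forall i, inner g (F x) (partial i F x) X = 0) ->
  J *m g (F x) *m X^T = 0.
Proof.
move=> h; apply/matrixP => i j; rewrite (ord1 j) [RHS]mxE -(h i) -row_jacobian.
by rewrite /inner -row_mul [LHS]mxE [RHS]mxE; apply: eq_bigr => k _; rewrite [in RHS]mxE.
Qed.

(** At the maximum the gradient is orthogonal to the [n] independent vectors [partial i F x], as is
    [nu x], so the two are parallel; comparing lengths gives [mu ^+ 2]. *)
Lemma grad_normal : exists2 mu, grad_height (F x) = mu *: nu x &
  mu ^+ 2 = (l - 1) ^+ 2.
Proof.
have nu0 : nu x != 0.
  apply/eqP => nu0; move: nu_unit; rewrite nu0 /inner !mul0mx mxE => /eqP.
  by rewrite eq_sym oner_eq0.
have JGf : row_free (J *m g (F x)).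
  rewrite /row_free mxrankMfree ?J_free // row_free_unit.
  exact: HnxR_metric_unit (F_in Ux).
have [|mu muE] := kernel_line JGf (jacobian_normal nu_orth)
  (@jacobian_normal (grad_height (F x)) _) nu0.
  move=> i; rewrite innerC inner_grad.
  by have [] := cosh_height_critical (delta_mx 0 i) oU Ux F2 F_in F_max.
exists mu => //; rewrite -(inner_grad_grad (F_in Ux)) muE.
by rewrite innerZl innerC innerZl nu_unit mulr1 expr2.
Qed.

(** Multiplying by [mu] replaces the normal by the explicit gradient, for which
    [christoffel_contract] evaluates the connection term. *)
Lemma second_formE mu i j : grad_height (F x) = mu *: nu x ->
  mu * II i j = inner g (F x) (grad_height (F x)) (partial i (partial j F) x)
    + l ^+ 3 * (2 * hdot (F x) (partial i F x) * hdot (F x) (partial j F x)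
        - hdot (F x) (F x) * hdot (partial i F x) (partial j F x)).
Proof.
move=> muE; rewrite mxE innerC -innerZl -muE /cov_partial [in LHS]innerE [in RHS]innerE.
under eq_bigr do rewrite [X in _ * X]mxE mulrDr.
rewrite big_split /= christoffel_contract ?F_in //; congr (_ + _ * _).
move: (partial i F x) (partial j F x) (F x) => X Y y.
rewrite !hdot_grad (hdotC y (grad_height _)) hdot_grad.
have twice (a b c : R) : a * b + b * a - c = 2 * a * b - c by ring.
exact: twice.
Qed.

(** Each term of [second_formE] is symmetric in [i] and [j], the first one by [partial_comm]. *)
Lemma second_form_sym mu : grad_height (F x) = mu *: nu x -> mu != 0 -> II^T = II.
Proof.
move=> muE mu0; apply/matrixP => i j; apply: (mulfI mu0).
rewrite mxE !(second_formE _ _ muE) (partial_comm oU Ux F2 i j).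
move: (partial i F x) (partial j F x) => X Y.
by rewrite (hdotC Y X) [2 * _ * _]mulrAC.
Qed.

(** Expresses the second form by the derivatives of [F] along [v], the quantities that
    [cosh_height_critical] controls. *)
Lemma second_form_quad mu v : grad_height (F x) = mu *: nu x ->
  mu * (v *m II *m v^T) 0 0 =
  inner g (F x) (grad_height (F x)) ('D_v ('D_v F) x)
    + l ^+ 3 * (2 * hdot (F x) ('D_v F x) ^+ 2
        - hdot (F x) (F x) * hdot ('D_v F x) ('D_v F x)).
Proof.
move=> muE; rewrite mx_quad mulr_sumr.
under eq_bigr do (rewrite mulr_sumr; under eq_bigr do
  rewrite mulrCA (second_formE _ _ muE)).
rewrite sum_quad; congr (_ + _ * (2 * _ ^+ 2 - _ * _)).
- rewrite (derive2_sum_partial oU Ux F2) innerC inner_suml; apply: eq_bigr => i _.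
  by rewrite inner_suml; apply: eq_bigr => j _; rewrite innerZl innerC.
- rewrite (derive_sum_partial _ (Ck2_differentiable F2 Ux)) hdotC hdot_suml.
  by apply: eq_bigr => i _; rewrite hdotC.
rewrite (derive_sum_partial _ (Ck2_differentiable F2 Ux)) hdot_suml.
apply: eq_bigr => i _; rewrite hdotC hdot_suml mulr_sumr; apply: eq_bigr => j _.
by move: (partial i F x) (partial j F x) => X Y; rewrite mulrA hdotC.
Qed.

Lemma touching_point : exists eps : R, [/\ eps ^+ 2 = 1, II^T = II,
  vcoord (nu x) != 0 & forall v : 'rV_n,
  (v *m I *m v^T) 0 0 - vcoord (v *m J) ^+ 2 <= eps * (v *m II *m v^T) 0 0].
Proof.
have [mu muE mu2] := grad_normal.
have y1 := F_in Ux.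
have l2 := conf_ge2 y1.
have C0 : 0 < l - 1 by lra.
have mu0 : mu != 0 by rewrite -sqrf_eq0 mu2 sqrf_eq0 gt_eqF.
(* With this sign, [eps *: nu x] is the unit vector opposite to the gradient, whose length is
   [l - 1]. *)
exists (- mu / (l - 1)); split.
- by rewrite expr_div_n sqrrN mu2 divff // sqrf_eq0 gt_eqF.
- exact: second_form_sym muE mu0.
- apply/eqP => nut; have := vcoord_grad (F x); rewrite muE /vcoord mxE -/(vcoord _).
  by rewrite nut mulr0 => /eqP; rewrite eq_sym oppr_eq0 oner_eq0.
move=> v; have [_] := cosh_height_critical v oU Ux F2 F_in F_max.
set Q := 'D_v ('D_v F) x; set X := 'D_v F x => crit.
have XE : v *m J = X by rewrite /X deriveEjacobian //; exact: Ck2_differentiable F2 _ Ux.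
have IE : (v *m I *m v^T) 0 0 = l ^+ 2 * hdot X X + vcoord X ^+ 2.
  by rewrite expr2 -inner_HnxR /inner -XE first_formE trmx_mul !mulmxA.
rewrite IE XE addrK [- mu / _ * _]mulrAC ler_pdivlMr // mulNr (second_form_quad _ muE).
rewrite inner_grad -/Q -/X.
move: crit; set a := hdot (F x) Q; set b := vcoord Q; set c := hdot (F x) X.
set h := hdot X X.
have := conf_hdot y1; set z := hdot (F x) (F x); set L := l => Lz.
have -> : L ^+ 3 * (2 * c ^+ 2 - z * h) = 2 * L ^+ 3 * c ^+ 2 - L ^+ 2 * h * (L * z).
  by ring.
(* After [L z = L - 2], the criticality inequality bounds [mu] times the second form by
   [- (L - 1) L^2 h]; dividing by [L - 1] leaves the horizontal part [L^2 h] of the first form. *)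
by rewrite Lz; clearbody a b c h z L; nra.
Qed.

End TouchingPoint.

(** * Positivity, continuity and orthonormal frames *)

Section MaximumPoint.
Variables (R : realType) (n : nat).
Local Notation g := (HnxR_metric R n).

Lemma inner_HnxR_gt0 (y X : 'rV[R]_(n + 1)) : hdot y y < 1 -> X != 0 ->
  0 < inner g y X X.
Proof.
move=> /conf_ge2 c2 X0; rewrite inner_HnxR -expr2.
have c0 : 0 < conf y ^+ 2 by rewrite exprn_gt0 // (lt_le_trans _ c2).
have s0 : 0 <= conf y ^+ 2 * hdot X X := mulr_ge0 (ltW c0) (hdot_ge0 X).
rewrite lt_neqAle (addr_ge0 s0 (sqr_ge0 _)) andbT eq_sym.
apply/negP; rewrite (paddr_eq0 s0 (sqr_ge0 _)).
rewrite mulf_eq0 (gt_eqF c0) /= sqrf_eq0 => /andP[/eqP h0 /eqP v0].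
move/eqP: X0; apply; apply/rowP => j.
rewrite [RHS]mxE; case: (split_ordP j) => k ->; last by rewrite (ord1 k).
move: h0; rewrite hdot.unlock => /eqP; rewrite psumr_eq0; last first.
  by move=> i _; rewrite -expr2 sqr_ge0.
by move=> /allP/(_ k); rewrite mem_index_enum -expr2 sqrf_eq0 => /(_ isT)/eqP.
Qed.

Lemma continuous_hdot (y : 'rV[R]_(n + 1)) :
  {for y, continuous (fun z : 'rV[R]_(n + 1) => hdot z z)}.
Proof.
have -> : (fun z => hdot z z) =
    \sum_(i < n) (fun z : 'rV[R]_(n + 1) => z 0 (lshift 1 i) * z 0 (lshift 1 i)).
  by apply/funext => z; rewrite hdot.unlock fct_sumE.
apply: differentiable_continuous; apply: differentiable_sum => i.
by apply: differentiableM; exact: differentiable_coord.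
Qed.

Lemma continuous_cosh_height (y : 'rV[R]_(n + 1)) : hdot y y < 1 ->
  {for y, continuous (@cosh_height R n)}.
Proof.
move=> y1; apply: continuousB; last exact: coord_continuous.
apply: continuousM; first exact: cst_continuous.
apply: continuousV; first by rewrite subr_eq0 gt_eqF.
by apply: continuousB; [exact: cst_continuous|exact: continuous_hdot].
Qed.

(** Near a point, [f] is its local representative composed with a chart, and level 0 of [smooth_on]
    is continuity. *)
Lemma immersion_continuous (m : nat) (M : topologicalType) (atlas : set (chart R n M))
    (Omega : set 'rV[R]_m) (f : M -> 'rV[R]_m) :
  smooth_manifold atlas -> smooth_immersion atlas Omega f -> continuous f.
Proof.
move=> hM hf p; have [c ac cp] := atlas_cover hM p.
have cc := atlas_chart hM ac.
have fE : \forall q \near p, (f \o chart_inv c) (chart_fun c q) = f q.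
  have : \forall q \near p, chart_dom c q.
    by apply: open_nbhs_nbhs; split=> //; exact: chart_dom_open.
  by apply: filterS => q cq; rewrite /= chart_funK.
have fpE : (f \o chart_inv c) (chart_fun c p) = f p by rewrite /= chart_funK.
change (f @ p --> f p); rewrite -fpE.
apply: cvg_trans (near_eq_cvg fE) _.
apply: (@continuous_comp _ _ _ (chart_fun c) (f \o chart_inv c) p).
  exact: chart_fun_continuous cc _ cp.
by apply: (immersion_smooth hf ac 0); exists p.
Qed.

Lemma hdot_delta_rshift (w : 'rV[R]_(n + 1)) :
  hdot w (delta_mx 0 (rshift n 0)) = 0.
Proof.
by rewrite hdot.unlock big1 // => i _; rewrite mxE eqxx eq_lrshift mulr0.
Qed.

(** The rows of [V *m J] together with [nu] form an orthonormal frame, so the squared vertical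
    components add up to the squared length of d/dt, which is 1. *)
Lemma bessel_eq (J : 'M[R]_(n, n + 1)) (V : 'M[R]_n) (y nu : 'rV[R]_(n + 1)) :
  V *m (J *m g y *m J^T) *m V^T = 1%:M -> J *m g y *m nu^T = 0 ->
  inner g y nu nu = 1 ->
  \sum_i vcoord (row i V *m J) ^+ 2 + vcoord nu ^+ 2 = 1.
Proof.
move=> VJ Jnu nu1; pose E := col_mx (V *m J) nu.
have EgE : E *m g y *m E^T = 1%:M.
  rewrite /E mul_col_mx tr_col_mx mul_col_row.
  have nuJ : nu *m g y *m (V *m J)^T = 0.
    apply: trmx_inj; rewrite trmx_mul trmxK trmx_mul HnxR_metric_sym trmx0.
    by rewrite -mulmxA (mulmxA J) Jnu mulmx0.
  have VJnu : V *m J *m g y *m nu^T = 0.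
    by rewrite -!mulmxA (mulmxA J) Jnu mulmx0.
  rewrite nuJ VJnu scalar_mx_block; congr block_mx.
    by rewrite -VJ trmx_mul !mulmxA.
  by apply/matrixP => i j; rewrite (ord1 i) (ord1 j) -/(inner _ _ _ _) nu1 mxE eqxx.
(* A one-sided inverse of a square matrix is two-sided; the last diagonal entry carries the vertical
   components. *)
have EE : (g y *m (E^T *m E)) (rshift n 0) (rshift n 0) = 1.
  by rewrite mulmxA (mulmx1C _) ?mulmxA // mxE eqxx.
move: EE; rewrite mxE (bigD1 (rshift n 0)) //= big1 => [|j jn]; last first.
  rewrite HnxR_metricE; case: (split_ordP j) jn => i -> jn.
    rewrite (hdotC (delta_mx 0 (rshift n 0))) hdot_delta_rshift mulr0 add0r.
    by rewrite /vcoord !mxE eqxx /= eq_rlshift mulr0 mul0r.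
  by rewrite (ord1 i) eqxx in jn.
have -> : g y (rshift n 0) (rshift n 0) = 1.
  by rewrite HnxR_metricE hdot_delta_rshift /vcoord !mxE !eqxx mulr0 add0r mulr1.
rewrite addr0 mul1r mxE big_split_ord /= big_ord1 => <-.
congr (_ + _); last by rewrite mxE col_mxEd expr2.
by apply: eq_bigr => i _; rewrite mxE col_mxEu expr2 -row_mul /vcoord !mxE.
Qed.

End MaximumPoint.

(** Homogeneity of degree [r], used to reverse the unit normal. *)
Lemma esym_scale (K : comNzRingType) n r (c : K) (k : 'I_n -> K) :
  \sum_(A : {set 'I_n} | #|A| == r) \prod_(i in A) (c * k i) =
  c ^+ r * \sum_(A : {set 'I_n} | #|A| == r) \prod_(i in A) k i.
Proof.
rewrite mulr_sumr; apply: eq_bigr => A /eqP <-.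
by rewrite big_split /= prodr_const.
Qed.

Theorem mainTheorem5 (R : realType) (n r : nat) (hr1 : (1 <= r)%N) (hrn : (r < n)%N)
    (M : topologicalType) (atlas : set (chart R n M))
    (hM : smooth_manifold atlas)
    (hM0 : [set: M] !=set0) (hMconn : connected [set: M])
    (f : M -> 'rV[R]_(n + 1)) (hf : smooth_immersion atlas (HnxR R n) f)
    (nu : M -> 'rV[R]_(n + 1))
    (hnu : unit_normal atlas (HnxR_metric R n) f nu)
    (k : M -> 'I_n -> R)
    (hk : forall p : M,
        principal_curvatures atlas (HnxR_metric R n) f nu p (k p))
    (hH : forall p : M,
        0 < r_mean_curvature r (k p) <= (n - r)%:R / n%:R) :
  ~ compact [set: M].
Proof.
move=> cM.
have f_in q : hdot (f q) (f q) < 1 by apply/HnxRE; exact: immersion_into hf q.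
have hcont : continuous (fun q => cosh_height (f q)).
  move=> q; apply: (@continuous_comp _ _ _ f (@cosh_height R n) q).
    exact: immersion_continuous hM hf q.
  exact: continuous_cosh_height.
(* Compactness and nonemptiness provide a global maximum point of [Phi]; a chart around it gives the
   parametrization [F]. *)
have [p _ pmax] := compact_EVT_max hM0 cM (continuous_subspaceT hcont).
have {}pmax q : cosh_height (f q) <= cosh_height (f p) by apply: pmax; rewrite inE.
have [c ac cp] := atlas_cover hM p.
have cc := atlas_chart hM ac.
pose F := f \o chart_inv c; pose x := chart_fun c p.
have xK : chart_inv c x = p by exact: chart_funK.
have Ux : chart_im c x by exists p.
have Fx : F x = f p by rewrite /F /= xK.
have nux : (nu \o chart_inv c) x = nu p by rewrite /= xK.
have Jf : row_free (jacobian F x) := immersion_injective_differential hf ac Ux.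
have orth i : inner (HnxR_metric R n) (F x) (partial i F x) ((nu \o chart_inv c) x) = 0.
  by rewrite Fx nux; exact: (normal_orthogonal hnu i ac cp).
have F2 : Ck_on 2 (chart_im c) F := immersion_smooth hf ac 2.
have F_in y : chart_im c y -> hdot (F y) (F y) < 1 by move=> _; exact: f_in.
have F_max y : chart_im c y -> cosh_height (F y) <= cosh_height (F x).
  by move=> _; rewrite Fx; exact: pmax.
have nu1 :
    inner (HnxR_metric R n) (F x) ((nu \o chart_inv c) x) ((nu \o chart_inv c) x) = 1.
  by rewrite Fx nux; exact: normal_unit hnu p.
have [eps [eps2 symII nut hess]] :=
  touching_point (chart_im_open cc) Ux F2 F_in F_max Jf nu1 orth.
have IE := first_formE Ux F2.
have symI : (first_form (HnxR_metric R n) F x)^T = first_form (HnxR_metric R n) F x.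
  by rewrite IE !trmx_mul trmxK HnxR_metric_sym mulmxA.
have posI (v : 'rV_n) : v != 0 -> 0 < (v *m first_form (HnxR_metric R n) F x *m v^T) 0 0.
  move=> v0; have -> : v *m first_form (HnxR_metric R n) F x *m v^T =
      (v *m jacobian F x) *m (HnxR_metric R n) (F x) *m (v *m jacobian F x)^T.
    by rewrite IE trmx_mul !mulmxA.
  by apply: inner_HnxR_gt0; [exact: F_in|rewrite mulmx_free_eq0].
(* The rows of [V] are the coordinates of an orthonormal tangent basis in which the second form has
   the principal curvatures on its diagonal. *)
have [V [VI VII]] := simultaneous_diag symI symII posI (hk p c ac cp).
have Jnu : jacobian F x *m (HnxR_metric R n) (F x) *m ((nu \o chart_inv c) x)^T = 0.
  exact: (jacobian_normal Ux F2 orth).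
have bes := bessel_eq (etrans (congr1 (fun G => V *m G *m V^T) (esym IE)) VI) Jnu nu1.
pose t i := vcoord (row i V *m jacobian F x) ^+ 2.
have rowVE (G : 'M[R]_n) i : (row i V *m G *m (row i V)^T) 0 0 = (V *m G *m V^T) i i.
  exact: (@inner_row _ _ _ _ (fun=> G) 0 V V i i).
have := @esym_gt R n r (fun i => eps * k p i) t.
rewrite hr1 ltnW // => /(_ isT).
have t0 i : 0 <= t i by exact: sqr_ge0.
(* Strict because the gradient has vertical part -1, so the normal parallel to it is not
   horizontal. *)
have t1 : \sum_i t i < 1.
  by rewrite -bes ltrDl lt_neqAle sqr_ge0 andbT eq_sym sqrf_eq0.
have tk i : 1 - t i <= eps * k p i.
  by have := hess (row i V); rewrite !rowVE VI VII mxE eqxx.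
move=> /(_ t0 t1 tk); rewrite esym_scale.
have /andP[H0 H1] := hH p.
set S := \sum_(A | _) _ => S_gt.
have C0 : (0 : R) < 'C(n, r)%:R by rewrite ltr0n bin_gt0 ltnW.
have S0 : 0 < S by move: H0; rewrite /r_mean_curvature pmulr_rgt0 ?invr_gt0.
(* The bound on [H_r] becomes this one through [n C(n-1, r) = (n - r) C(n, r)]. *)
have S1 : S <= 'C(n.-1, r)%:R.
  have n0 : (0 : R) < n%:R by rewrite ltr0n (leq_ltn_trans _ hrn).
  move: H1; rewrite /r_mean_curvature -/S mulrC ler_pdivrMr // mulrAC.
  rewrite ler_pdivlMr // -natrM -mul_bin_down natrM mulrC.
  by rewrite ler_pM2l.
(* As [S > 0], this bound gives [eps ^+ r * S <= S] for both signs of [eps] and any parity of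
   [r]. *)
have eps_le : eps ^+ r <= 1.
  apply: le_trans (ler_norm _) _; rewrite normrX.
  have /eqP : `|eps| ^+ 2 = 1 by rewrite -normrX eps2 normr1.
  by rewrite sqrp_eq1 // => /eqP ->; rewrite expr1n.
have : S < S by apply: le_lt_trans S1 (lt_le_trans S_gt _); rewrite ler_piMl // ltW.
by rewrite ltxx.
Qed.
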